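(* Let $\theta\in(0,\pi)$ with $\sin 2\theta\neq 0$, $\lambda_0=2\cos\theta$, $\rho=\frac{1}{2\sin\theta}$. Let $(\omega_j)_{j\ge1}$ be i.i.d. real random variables with $\mathbb{E}\omega_j=0$, $\mathbb{E}\omega_j^2=1$ and $|\omega_j|<c_0$ almost surely. Let $0<\sigma\le \frac{2\sin\theta\,|\sin2\theta|}{460c_0^3}$ and $0\le \kappa\le 6c_0^3\rho^3\sigma^3/|\sin2\theta|$. Then for every $B>0$, $$\mathbb{P}\big(\exists\, n\ge1:\ (\log Y_n+\kappa n)-(\log Y_1+\kappa)\ge B\big)\le 2\exp\!\Big(-B\Big(1-\frac{230c_0^3\sigma}{2\sin\theta\,|\sin2\theta|}\Big)\Big).$$
   Context: Let $z=e^{i\theta}$, $T_i=\begin{pmatrix}\lambda_0-\sigma\omega_i&-1\\1&0\end{pmatrix}$, $W_k=T_k\cdots T_1$, and define $X_k,Y_k\in\mathbb{R}$, $Y_k>0$, by $X_k+iY_k=W_k^{-1}\circ z$, where a real $2\times2$ matrix $\begin{pmatrix}a&b\\c&d\end{pmatrix}$ of positive determinant acts on the upper half plane by $w\mapsto\frac{aw+b}{cw+d}$. *)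

(* Defs.v *)
From HB Require Import structures.
From mathcomp Require Import all_boot all_order all_algebra.
From mathcomp Require Import all_classical all_reals all_analysis.
From mathcomp Require Import complex.
Set Implicit Arguments. Unset Strict Implicit. Unset Printing Implicit Defensive.
Import Order.TTheory GRing.Theory Num.Theory.
Local Open Scope classical_set_scope.
Local Open Scope ring_scope.

Definition mutually_independent d (T : measurableType d) (R : realType)
  (P : probability T R) (X : nat -> T -> R) : Prop :=
  forall (I : seq nat) (B : nat -> set R), uniq I ->
    (forall i, measurable (B i)) ->
    P (\bigcap_(i in [set` I]) (X i @^-1` B i)) =
    (\prod_(i <- I) P (X i @^-1` B i))%E.

Definition identically_distributed d (T : measurableType d) (R : realType)
  (P : probability T R) (X : nat -> T -> R) : Prop :=
  forall (i : nat) (B : set R), measurable B ->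
    P (X i @^-1` B) = P (X 0%N @^-1` B).

Definition mobius (R : rcfType) (A : 'M[R]_2) (w : R[i]) : R[i] :=
  (((A 0 0)%:C)%C * w + ((A 0 1)%:C)%C) / (((A 1 0)%:C)%C * w + ((A 1 1)%:C)%C).

Definition transfer (R : rcfType) (lambda0 sigma om : R) : 'M[R]_2 :=
  \matrix_(i < 2, j < 2)
    (if (i == 0) && (j == 0) then lambda0 - sigma * om
     else if (i == 0) && (j == 1) then -1
     else if (i == 1) && (j == 0) then 1 else 0).

(* W_k = T_k ... T_1, where the i-th matrix (i >= 1) uses omega_i = om i. *)
Fixpoint Wprod (R : rcfType) (lambda0 sigma : R) (om : nat -> R) (k : nat)
  : 'M[R]_2 :=
  match k with
  | 0%N => 1%:M
  | k'.+1 => transfer lambda0 sigma (om k) *m Wprod lambda0 sigma om k'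
  end.

Definition Yk (R : realType) (theta sigma : R) (om : nat -> R) (k : nat) : R :=
  complex.Im (mobius (invmx (Wprod (2 * cos theta) sigma om k))
                     (cos theta +i* sin theta)%C).

(* Main.v *)
(** Acting on the first column of W_k, one gets Y_k = sin theta / |u_k|^2 where
    u_k = W_k(0,0) - W_k(1,0) z, and u_k arises from u_(k-1) by the rotation of angle
    -theta followed by the shear w |-> w + t Im w with t = sigma omega_k / sin theta.
    If phi is the argument of the rotated vector, |u_k|^2 is multiplied by
    r = 1 + t sin 2phi + t^2 (1 - cos 2phi) / 2, and a second-order expansion gives
    E r^(-s) = 1 + K (s - 1 + 2 cos 2phi - (s + 1) cos 4phi) + O(t^3)
    with K = s (sigma / sin theta)^2 / 4.  The oscillating terms are coboundaries of the
    rotation: multiplying by 1 + K g(phi), with g bounded by O(1 / |sin 2theta|), removes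
    them.  For s = 1 - 230 c0^3 sigma / (2 sin theta |sin 2theta|) the remaining drift
    K (s - 1) absorbs both kappa and all the cubic errors, so that
    (1 + K g) (Y_n e^(kappa n))^s is a nonnegative supermartingale, and the maximal
    inequality gives the bound; the factor 2 pays for the two values of 1 + K g. *)
Require Import Defs.
From HB Require Import structures.
From mathcomp Require Import all_boot all_order all_algebra.
From mathcomp Require Import all_classical all_reals all_analysis.
From mathcomp Require Import measurable_realfun measurable_fun_approximation.
From mathcomp Require Import complex.
From mathcomp Require Import ring lra.
Import Order.TTheory GRing.Theory Num.Theory.
Import numFieldNormedType.Exports.
Local Open Scope classical_set_scope.
Local Open Scope ring_scope.

(** * Second-order Taylor bounds for negative powers near 1 *)

(** The polynomial [p] agrees to second order with [r ^ (- s)] at [r = 1], so in the combination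
    [r p' + s p] the terms of degree 0 and 1 in [r - 1] cancel. What remains is a square times a
    factor whose sign can be read off. *)
Lemma powRN_taylor2_deriv (R : realType) (s a r : R) : 0 < r ->
  is_derive r 1 (fun r => (1 - s * (r - 1) + s * (s + 1) / 2 * (r - 1) ^+ 2
                           + a * (r - 1) ^+ 3) * r `^ s)
    (r `^ (s - 1) * ((r - 1) ^+ 2 *
      (s * (s + 1) * (s + 2) / 2 + 3 * a * r + s * a * (r - 1)))).
Proof.
move=> r0.
pose p : {poly R} := 1 - s *: ('X - 1) + (s * (s + 1) / 2) *: ('X - 1) ^+ 2
   + a *: ('X - 1) ^+ 3.
have -> : (fun r => (1 - s * (r - 1) + s * (s + 1) / 2 * (r - 1) ^+ 2
   + a * (r - 1) ^+ 3) * r `^ s) = (horner p : R -> R) * (@powR R ^~ s).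
  apply/funext => x; rewrite -[RHS]/(p.[x] * x `^ s) /p !hornerE.
  by rewrite /=; ring.
have D := is_deriveM (is_derive_poly p r) (is_derive1_powR s r0).
apply: (is_derive_eq D); rewrite /p !poly.derivE !hornerE /=.
have -> : r `^ s = r * r `^ (s - 1).
  by rewrite -{2}[r]powRr1 ?ltW// -powRD ?(gt_eqF r0) ?implybT// addrC subrK.
by rewrite /GRing.scale /=; field.
Qed.

(** Multiplying by [(1 + x) ^ s] turns the claim into a comparison of a function with its value 1 at
    [r = 1], which follows from the sign of its derivative. *)
Lemma powRN_le_taylor2 (R : realType) (s x : R) : 0 <= s <= 1 ->
  - 100^-1 <= x <= 100^-1 ->
  (1 + x) `^ (- s) <=
  1 - s * x + s * (s + 1) / 2 * x ^+ 2 + 2 * s * `|x| ^+ 3.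
Proof.
move=> /andP[s0 s1] /andP[x1 x2].
have r0 : 0 < 1 + x by lra.
(* A cubic coefficient [a] chosen by the sign of [x] replaces the absolute value by a polynomial:
   [a = 0] for [x >= 0] and [a = - 2 s] for [x < 0]. *)
have key : exists a : R, a * x ^+ 3 <= 2 * s * `|x| ^+ 3 /\
    1 <= (1 - s * x + s * (s + 1) / 2 * x ^+ 2 + a * x ^+ 3) * (1 + x) `^ s.
  pose h (a r : R) : R := (1 - s * (r - 1) + s * (s + 1) / 2 * (r - 1) ^+ 2
                           + a * (r - 1) ^+ 3) * r `^ s.
  have dh a (r : R) : 0 < r -> derivable (h a) r 1.
    by move=> /(powRN_taylor2_deriv R s a r)[].
  have dhE a (r : R) : 0 < r -> derive1 (h a) r = r `^ (s - 1) * ((r - 1) ^+ 2 *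
        (s * (s + 1) * (s + 2) / 2 + 3 * a * r + s * a * (r - 1))).
    by move=> /(powRN_taylor2_deriv R s a r)[_ <-]; rewrite derive1E.
  have ch a (u v : R) : 0 < u -> {within `[u, v], continuous (h a)}.
    move=> u0; apply: derivable_within_continuous => z; rewrite in_itv /=.
    by move=> /andP[uz _]; apply: dh; lra.
  have h1 a : h a 1 = 1.
    by rewrite /h subrr !expr0n /= !mulr0 subr0 !addr0 powR1 mulr1.
  have hx a : h a (1 + x) =
      (1 - s * x + s * (s + 1) / 2 * x ^+ 2 + a * x ^+ 3) * (1 + x) `^ s.
    by rewrite /h [1 + x]addrC addrK.
  have [x0|x0] := leP 0 x.
  - exists 0; split; first by rewrite mul0r !mulr_ge0 ?exprn_ge0.
    rewrite -hx -[leLHS](h1 0).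
    refine (@ger0_derive1_ndecr _ (h 0) 1 (1 + x) _ _ _ 1 (1 + x) _ _ _); last 3 first.
    + exact: lexx.
    + lra.
    + exact: lexx.
    + by move=> r; rewrite in_itv /= => /andP[? _]; apply: dh; lra.
    + move=> r; rewrite in_itv /= => /andP[? _].
      rewrite dhE; last lra.
      by rewrite mulr_ge0 ?powR_ge0// mulr_ge0 ?sqr_ge0//; nra.
    + by apply: ch; lra.
  (* Here [a x^3 = 2 s |x|^3], and the derivative is nonpositive because [6 r] stays close to 6
     while [(s + 1)(s + 2) / 2 <= 3]. *)
  - exists (- 2 * s); split.
      by rewrite ltr0_norm//; nra.
    rewrite -hx -[leLHS](h1 (- 2 * s)).
    refine (@ler0_derive1_nincr _ (h (- 2 * s)) (1 + x) 1 _ _ _ (1 + x) 1 _ _ _); last 3 first.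
    + exact: lexx.
    + lra.
    + exact: lexx.
    + by move=> r; rewrite in_itv /= => /andP[? _]; apply: dh; lra.
    + move=> r; rewrite in_itv /= => /andP[? ?].
      rewrite dhE; last lra.
      rewrite mulr_ge0_le0 ?powR_ge0// mulr_ge0_le0 ?sqr_ge0//.
      have -> : s * (s + 1) * (s + 2) / 2 + 3 * (- 2 * s) * r +
        s * (- 2 * s) * (r - 1) =
        - (s * (6 * r + 2 * s * (r - 1) - (s + 1) * (s + 2) / 2)) by field.
      rewrite oppr_le0 mulr_ge0//.
      have : (s + 1) * (s + 2) <= 6 by nra.
      have : s * (1 - r) <= 1 - r by nra.
      lra.
    + by apply: ch; lra.
case: key => a [ax k]; have p0 : 0 < (1 + x) `^ s by apply: powR_gt0.
rewrite powRN -[_^-1]mul1r ler_pdivrMr//; apply: (le_trans k).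
by rewrite ler_pM2r// lerD2l.
Qed.

(** * The corrector that removes the oscillating terms *)

(* With x = cos 2phi and y = sin 2phi, this is the function g solving
   g(phi + theta) - g(phi) = 2 cos 2phi - (s + 1) cos 4phi. *)
Definition corrector (R : realType) (theta s x y : R) : R :=
  (y * cos theta - x * sin theta) / sin theta
  - (s + 1) / (2 * sin (2 * theta)) *
    (2 * x * y * cos (2 * theta) - (x ^+ 2 - y ^+ 2) * sin (2 * theta)).

(** The two terms are [sin (2 phi - theta) / sin theta] and a multiple of
    [sin (4 phi - 2 theta) / sin (2 theta)]. Advancing [phi] by [theta] flips the sign of each
    shift, and the difference of sines produces [2 cos 2phi] and [(s + 1) cos 4phi]. *)
Lemma corrector_rot (R : realType) (theta s x y : R) :
  sin theta != 0 -> sin (2 * theta) != 0 ->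
  corrector R theta s (x * cos (2 * theta) - y * sin (2 * theta))
                    (y * cos (2 * theta) + x * sin (2 * theta)) =
  corrector R theta s x y + 2 * x - (s + 1) * (x ^+ 2 - y ^+ 2).
Proof.
rewrite /corrector => s0 s20.
have e1 := cos2Dsin2 theta; have e2 := cos2Dsin2 (2 * theta).
have c2 : cos (2 * theta) = cos theta ^+ 2 - sin theta ^+ 2.
  by rewrite mulr_natl mulr2n cosD -!expr2.
have s2 : sin (2 * theta) = 2 * sin theta * cos theta.
  by rewrite mulr_natl mulr2n sinD; ring.
have -> : (y * cos (2 * theta) + x * sin (2 * theta)) * cos theta -
  (x * cos (2 * theta) - y * sin (2 * theta)) * sin theta =
  (y * cos theta + x * sin theta) * (cos theta ^+ 2 + sin theta ^+ 2).
  by rewrite c2 s2; ring.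
rewrite e1 mulr1.
set c := cos (2 * theta) in e2 *; set si := sin (2 * theta) in e2 s20 *.
have -> : 2 * (x * c - y * si) * (y * c + x * si) * c -
  ((x * c - y * si) ^+ 2 - (y * c + x * si) ^+ 2) * si =
  (2 * x * y * c + (x ^+ 2 - y ^+ 2) * si) * (c ^+ 2 + si ^+ 2) by ring.
rewrite e2 mulr1; field.
by rewrite s0 s20.
Qed.

(** Multiplication by [sin (2 * theta)], a multiple of [sin theta], clears both denominators and
    leaves trigonometric factors of size at most 1. The linear part contributes 2 and the quadratic
    part 4 to the constant 6. The bound is stated on the whole square, so that it can also be used
    away from the unit circle. *)
Lemma corrector_lipschitz (R : realType) (theta s x y x' y' : R) :
  0 < sin theta -> sin (2 * theta) != 0 -> 0 <= s <= 1 ->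
  `|x| <= 1 -> `|y| <= 1 -> `|x'| <= 1 -> `|y'| <= 1 ->
  `|corrector R theta s x' y' - corrector R theta s x y| <=
  6 * (`|x' - x| + `|y' - y|) / `|sin (2 * theta)|.
Proof.
move=> s0 s20 /andP[s1 s2] hx hy hx' hy'.
have D0 : 0 < `|sin (2 * theta)| by rewrite normr_gt0.
have sE : sin (2 * theta) = 2 * sin theta * cos theta.
  by rewrite mulr_natl mulr2n sinD; ring.
rewrite ler_pdivlMr// -normrM.
set dx := x' - x; set dy := y' - y.
have -> : (corrector R theta s x' y' - corrector R theta s x y)
            * sin (2 * theta) =
  2 * cos theta * (dy * cos theta - dx * sin theta) - (s + 1) / 2 *
   (2 * (x' * dy + y * dx) * cos (2 * theta)
    - (dx * (x' + x) - dy * (y' + y)) * sin (2 * theta)).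
  have c0 : cos theta != 0 by apply: contra_neq s20; rewrite sE => ->; rewrite mulr0.
  rewrite /corrector /dx /dy sE; field.
  by rewrite c0 gt_eqF.
have b (u v M : R) : `|u| <= 1 -> `|v| <= M -> `|u * v| <= M.
  move=> u1 vM; rewrite normrM (le_trans _ vM)// ler_piMl//.
have c1 (z : R) : `|cos z| <= 1 by rewrite ler_norml cos_geN1 cos_le1.
have n1 (z : R) : `|sin z| <= 1 by rewrite ler_norml sin_geN1 sin_le1.
set a := `|dx|; set e := `|dy|.
have t1 : `|cos theta * (dy * cos theta - dx * sin theta)| <= a + e.
  apply: (b _ _ _) => //; apply: (le_trans (ler_normB _ _)).
  by rewrite addrC lerD// mulrC b.
have t2 : `|(x' * dy + y * dx) * cos (2 * theta)| <= a + e.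
  rewrite mulrC; apply: (b _ _ _) => //; apply: (le_trans (ler_normD _ _)).
  by rewrite addrC lerD// b.
have sum2 (u v : R) : `|u| <= 1 -> `|v| <= 1 -> `|(u + v) / 2| <= 1.
  by rewrite !ler_norml; lra.
have t3 : `|(dx * ((x' + x) / 2) - dy * ((y' + y) / 2)) * sin (2 * theta)|
    <= a + e.
  rewrite mulrC; apply: (b _ _ _) => //; apply: (le_trans (ler_normB _ _)).
  by rewrite lerD// mulrC b// sum2.
have t4 : `|(s + 1) / 2 * ((x' * dy + y * dx) * cos (2 * theta)
   - (dx * ((x' + x) / 2) - dy * ((y' + y) / 2)) * sin (2 * theta))|
   <= (a + e) + (a + e).
  apply: (b _ _ _); first by rewrite ger0_norm; lra.
  by apply: (le_trans (ler_normB _ _)); rewrite lerD.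
move: t1 t4; rewrite !ler_norml.
set A := cos theta * _; set B := (s + 1) / 2 * _.
have -> : 2 * cos theta * (dy * cos theta - dx * sin theta) -
  (s + 1) / 2 * (2 * (x' * dy + y * dx) * cos (2 * theta) -
   (dx * (x' + x) - dy * (y' + y)) * sin (2 * theta)) = 2 * A - 2 * B.
  by rewrite /A /B; field.
move: (normr_ge0 dx) (normr_ge0 dy); rewrite -/a -/e; lra.
Qed.

(** The corrector vanishes at the origin of the square, so the Lipschitz bound from there gives
    [6 * 2 = 12]. *)
Lemma corrector_bound (R : realType) (theta s x y : R) :
  0 < sin theta -> sin (2 * theta) != 0 -> 0 <= s <= 1 ->
  `|x| <= 1 -> `|y| <= 1 ->
  `|corrector R theta s x y| <= 12 / `|sin (2 * theta)|.
Proof.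
move=> s0 s20 sI hx hy.
have := corrector_lipschitz R theta s 0 0 x y s0 s20 sI.
have -> : corrector R theta s 0 0 = 0.
  by rewrite /corrector; ring.
rewrite !subr0 normr0 ler01 => /(_ isT isT hx hy) /le_trans; apply.
by rewrite ler_pM2r ?invr_gt0 ?normr_gt0//; lra.
Qed.

(** * Effect of one shear on the norm and on the doubled angle *)

Lemma normr_le1_circle (R : realType) (x y : R) :
  x ^+ 2 + y ^+ 2 = 1 -> `|x| <= 1.
Proof.
move=> xy; rewrite -ler_sqr ?nnegrE// real_normK ?num_real// expr1n -xy.
by rewrite lerDl sqr_ge0.
Qed.

(** With [x = cos 2phi] and [y = sin 2phi], the bounded quantity is the relative change of the
    squared norm under [w |-> w + t Im w], since [sin^2 phi = (1 - x) / 2]. *)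
Lemma shear_ratio_bound (R : realType) (t x y : R) :
  x ^+ 2 + y ^+ 2 = 1 ->
  `|t * y + t ^+ 2 * (1 - x) / 2| <= `|t| + `|t| ^+ 2.
Proof.
move=> xy.
have /andP[x1 x2] : -1 <= x <= 1 by rewrite -ler_norml (normr_le1_circle R x y).
have y1 : `|y| <= 1 by rewrite (normr_le1_circle R y x)// addrC.
apply: (le_trans (ler_normD _ _)); rewrite lerD//.
  by rewrite normrM ler_piMr.
rewrite -[`|t| ^+ 2]normrX -mulrA normrM ler_piMr//.
by rewrite ger0_norm; lra.
Qed.

(** From below, [exp v >= 1 + v] and [ln (1 + x) <= x] give [1 - s x]; from above, the Taylor bound
    applies. *)
Lemma powRN_sub1_bound (R : realType) (s x : R) : 0 <= s <= 1 ->
  `|x| <= 200^-1 -> `|(1 + x) `^ (- s) - 1| <= 101 / 100 * `|x|.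
Proof.
move=> sI hx; have /andP[s0 s1] := sI.
have [xl xu] : - 200^-1 <= x /\ x <= 200^-1.
  by move: hx; rewrite ler_norml => /andP[].
have r0 : 0 < 1 + x by lra.
have lo : 1 - s * x <= (1 + x) `^ (- s).
  rewrite /powR gt_eqF//; apply: le_trans (expR_ge1Dx _).
  by rewrite lerD2l mulNr lerN2 ler_wpM2l// le_ln1Dx//; lra.
have hi : (1 + x) `^ (- s) <=
    1 - s * x + s * (s + 1) / 2 * x ^+ 2 + 2 * s * `|x| ^+ 3.
  by apply: powRN_le_taylor2 => //; apply/andP; split; lra.
have xx : x ^+ 2 = `|x| ^+ 2 by rewrite -normrX ger0_norm ?sqr_ge0.
have m0 := normr_ge0 x.
have [sx1 sx2] : s * x <= `|x| /\ - `|x| <= s * x.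
  have : `|s * x| <= `|x| by rewrite normrM (ger0_norm s0) ler_piMl.
  by rewrite ler_norml => /andP[].
have m2 : `|x| ^+ 2 <= 200^-1 * `|x| by rewrite expr2 ler_wpM2r.
have m3 : `|x| ^+ 3 <= 200^-1 * (200^-1 * `|x|).
  by rewrite exprS ler_pM// exprn_ge0.
have m3' : 0 <= `|x| ^+ 3 by apply: exprn_ge0.
have q : s * (s + 1) / 2 * x ^+ 2 <= `|x| ^+ 2.
  rewrite xx ler_piMl ?sqr_ge0//.
  by have := ler_piMl s0 s1; lra.
have q3 : 2 * s * `|x| ^+ 3 <= 2 * `|x| ^+ 3 by rewrite ler_wpM2r//; lra.
by rewrite ler_norml; apply/andP; split; lra.
Qed.

(** The two quotients are the cosine and sine of the doubled angle after the shear. Their increments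
    reduce to [(1 - x) d / (1 + d)] and [(t (1 - x) - y d) / (1 + d)], where [d] is the relative
    change of the squared norm, itself of order [t]. *)
Lemma shear_angle_bound (R : realType) (t x y : R) :
  x ^+ 2 + y ^+ 2 = 1 -> `|t| <= 230^-1 ->
  let r := 1 + (t * y + t ^+ 2 * (1 - x) / 2) in
  `|(x + t * y + t ^+ 2 * (1 - x) / 2) / r - x| +
  `|(y + t * (1 - x)) / r - y| <= 52 / 10 * `|t|.
Proof.
move=> xy t0; set d := t * y + _; rewrite /=.
have dm : `|d| <= `|t| + `|t| ^+ 2 by apply: shear_ratio_bound.
have /andP[x1 x2] : -1 <= x <= 1 by rewrite -ler_norml (normr_le1_circle R x y).
have y1 : `|y| <= 1 by rewrite (normr_le1_circle R y x)// addrC.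
have m0 := normr_ge0 t.
have m2 : `|t| ^+ 2 <= 230^-1 * `|t| by rewrite expr2 ler_wpM2r.
have r0 : 99 / 100 <= 1 + d.
  have : - `|d| <= d by rewrite lerNl -normrN ler_norm.
  lra.
have rn0 : 1 + d != 0 by apply/eqP; lra.
have -> : (x + t * y + t ^+ 2 * (1 - x) / 2) / (1 + d) - x =
    ((1 - x) * d) / (1 + d).
  by apply: (mulIf rn0); rewrite mulrBl !divfK// /d; ring.
have -> : (y + t * (1 - x)) / (1 + d) - y = (t * (1 - x) - y * d) / (1 + d).
  by apply: (mulIf rn0); rewrite mulrBl !divfK//; ring.
rewrite !normrM normfV (ger0_norm (_ : 0 <= 1 + d)); last lra.
rewrite -mulrDl ler_pdivrMr; last lra.
have e1 : `|1 - x| <= 2 by rewrite ger0_norm; lra.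
have e2 : `|1 - x| * `|d| <= 2 * `|d| by rewrite ler_wpM2r.
have e3 : `|t * (1 - x) - y * d| <= 2 * `|t| + `|d|.
  apply: (le_trans (ler_normB _ _)); rewrite !normrM lerD//.
    by rewrite mulrC ler_wpM2r.
  by rewrite ler_piMl.
have e4 : 99 / 100 * `|t| <= (1 + d) * `|t| by rewrite ler_wpM2r.
lra.
Qed.

(** Only [t^2 y^2] is kept from [d^2]. The discarded part costs at most [2.01 s |t|^3] and the
    Taylor remainder at most [2.04 s |t|^3]; the constant 5 covers both. *)
Lemma shear_ratio_taylor (R : realType) (s t x y : R) :
  0 <= s <= 1 -> x ^+ 2 + y ^+ 2 = 1 -> `|t| <= 230^-1 ->
  (1 + (t * y + t ^+ 2 * (1 - x) / 2)) `^ (- s) <=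
  1 - s * t * y + t ^+ 2 * (s * (s + 1) / 2 * y ^+ 2 - s * (1 - x) / 2)
  + 5 * s * `|t| ^+ 3.
Proof.
move=> sI xy t0; have /andP[s1 s2] := sI.
set d := t * y + _.
have x1 : `|x| <= 1 by rewrite (normr_le1_circle R x y).
have y1 : `|y| <= 1 by rewrite (normr_le1_circle R y x)// addrC.
have m0 := normr_ge0 t.
have dm : `|d| <= 231 / 230 * `|t|.
  have : `|d| <= `|t| + `|t| ^+ 2 by apply: shear_ratio_bound.
  have : `|t| ^+ 2 <= 230^-1 * `|t| by rewrite expr2 ler_wpM2r.
  lra.
have tay : (1 + d) `^ (- s) <=
    1 - s * d + s * (s + 1) / 2 * d ^+ 2 + 2 * s * `|d| ^+ 3.
  apply: powRN_le_taylor2 => //; rewrite -ler_norml; clear -dm t0; lra.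
have m3 : 0 <= `|t| ^+ 3 by apply: exprn_ge0.
have d2 : d ^+ 2 = t ^+ 2 * y ^+ 2 + (t ^+ 3 * (y * (1 - x))
    + t ^+ 4 * ((1 - x) / 2) ^+ 2) by rewrite /d; field.
have d2b : t ^+ 3 * (y * (1 - x)) + t ^+ 4 * ((1 - x) / 2) ^+ 2 <=
    201 / 100 * `|t| ^+ 3.
  have /andP[x3 x4] : -1 <= x <= 1 by rewrite -ler_norml.
  have : t ^+ 3 * (y * (1 - x)) <= 2 * `|t| ^+ 3.
    apply: (le_trans (ler_norm _)); rewrite normrM normrX mulrC ler_wpM2r//.
    rewrite normrM (ger0_norm (_ : 0 <= 1 - x)); last lra.
    apply: (@le_trans _ _ (1 * (1 - x))); [rewrite ler_wpM2r//|]; clear -x3 x4; lra.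
  have : t ^+ 4 * ((1 - x) / 2) ^+ 2 <= 230^-1 * `|t| ^+ 3.
    apply: (@le_trans _ _ (`|t| ^+ 4)).
      rewrite -normrX (ger0_norm (_ : 0 <= t ^+ 4)) ?exprn_even_ge0//.
      by rewrite ler_piMr ?exprn_even_ge0// exprn_ile1//; clear -x3 x4; lra.
    by rewrite exprS ler_wpM2r.
  lra.
have d3 : `|d| ^+ 3 <= 102 / 100 * `|t| ^+ 3.
  apply: (@le_trans _ _ ((231 / 230 * `|t|) ^+ 3)).
    by rewrite lerXn2r ?nnegrE// mulr_ge0//; clear; lra.
  by rewrite exprMn ler_wpM2r//; clear; lra.
have c0 : 0 <= s * (s + 1) / 2 <= s.
  have := ler_piMl s1 s2; have := mulr_ge0 s1 s1.
  by clear -s1; move=> *; apply/andP; split; lra.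
have [c1 c2] := andP c0.
have f1 := ler_wpM2l c1 d2b.
have f2 : s * (s + 1) / 2 * (201 / 100 * `|t| ^+ 3) <=
    s * (201 / 100 * `|t| ^+ 3) by rewrite ler_wpM2r// mulr_ge0//; clear; lra.
have f3 : 2 * s * `|d| ^+ 3 <= 2 * s * (102 / 100 * `|t| ^+ 3).
  by rewrite ler_wpM2l// mulr_ge0.
have f4 : 0 <= s * `|t| ^+ 3 by apply: mulr_ge0.
apply: (le_trans tay); rewrite d2.
have -> : 1 - s * d = 1 - s * t * y - t ^+ 2 * (s * (1 - x) / 2).
  by rewrite /d; field.
lra.
Qed.

Lemma shear_potential (R : realType) (theta s t K x y : R) :
  0 < sin theta -> sin (2 * theta) != 0 -> 0 <= s <= 1 -> 0 <= K ->
  x ^+ 2 + y ^+ 2 = 1 -> `|t| <= 230^-1 ->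
  let r := 1 + (t * y + t ^+ 2 * (1 - x) / 2) in
  (1 + K * corrector R theta s ((x + t * y + t ^+ 2 * (1 - x) / 2) / r)
                               ((y + t * (1 - x)) / r)) * r `^ (- s) <=
  1 - s * t * y + t ^+ 2 * (s * (s + 1) / 2 * y ^+ 2 - s * (1 - x) / 2)
  + 5 * s * `|t| ^+ 3 + K * corrector R theta s x y
  + 47 * K * `|t| / `|sin (2 * theta)|.
Proof.
move=> s0 s20 sI K0 xy t0; have /andP[s1 s2] := sI.
set d := t * y + _; rewrite /=.
set x' := (x + _ + _) / _; set y' := (y + _) / (1 + d).
have D0 : 0 < `|sin (2 * theta)| by rewrite normr_gt0.
have dm : `|d| <= `|t| + `|t| ^+ 2 by apply: shear_ratio_bound.
have ab := shear_angle_bound R t x y xy t0; rewrite /= -/d -/x' -/y' in ab.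
have x1 : `|x| <= 1 by rewrite (normr_le1_circle R x y).
have y1 : `|y| <= 1 by rewrite (normr_le1_circle R y x)// addrC.
have m0 := normr_ge0 t.
have m2 : `|t| ^+ 2 <= 230^-1 * `|t| by rewrite expr2 ler_wpM2r.
have d200 : `|d| <= 200^-1 by lra.
have [dl du] : - 200^-1 <= d /\ d <= 200^-1.
  by move: d200; rewrite ler_norml => /andP[].
have rn0 : 1 + d != 0 by apply/eqP; lra.
have xy' : x' ^+ 2 + y' ^+ 2 = 1.
  have -> : x' ^+ 2 + y' ^+ 2 = ((x + t * y + t ^+ 2 * (1 - x) / 2) ^+ 2 +
      (y + t * (1 - x)) ^+ 2) / (1 + d) ^+ 2.
    by rewrite [RHS]mulrDl /x' /y' !expr_div_n.
  have -> : (x + t * y + t ^+ 2 * (1 - x) / 2) ^+ 2 + (y + t * (1 - x)) ^+ 2 =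
      (x ^+ 2 + y ^+ 2 - 1) + (1 + d) ^+ 2 by rewrite /d; field.
  by rewrite xy subrr add0r divff// expf_neq0.
have x'1 : `|x'| <= 1 by rewrite (normr_le1_circle R x' y').
have y'1 : `|y'| <= 1 by rewrite (normr_le1_circle R y' x')// addrC.
have lip := corrector_lipschitz R theta s x y x' y' s0 s20 sI x1 y1 x'1 y'1.
have gb := corrector_bound R theta s x y s0 s20 sI x1 y1.
have qb := powRN_sub1_bound R s d sI d200.
set q := (1 + d) `^ (- s) in qb *.
set g := corrector R theta s x y in lip gb *.
set g' := corrector R theta s x' y' in lip *.
have E1 := shear_ratio_taylor R s t x y sI xy t0; rewrite -/d -/q in E1.
have qq : `|q| <= 101 / 100.
  have := ler_normD 1 (q - 1); rewrite [1 + _]addrC subrK normr1; lra.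
have E2 : (g' - g) * q <= 32 * `|t| / `|sin (2 * theta)|.
  apply: (le_trans (ler_norm _)); rewrite normrM.
  have -> : 32 * `|t| / `|sin (2 * theta)| =
     (32 * (100 / 101) * `|t| / `|sin (2 * theta)|) * (101 / 100) by field; rewrite gt_eqF.
  apply: ler_pM => //; apply: (le_trans lip).
  by rewrite ler_pM2r ?invr_gt0//; lra.
have E3 : g * (q - 1) <= 13 * `|t| / `|sin (2 * theta)|.
  apply: (le_trans (ler_norm _)); rewrite normrM.
  have -> : 13 * `|t| / `|sin (2 * theta)| =
     12 / `|sin (2 * theta)| * (13 / 12 * `|t|) by field; rewrite gt_eqF.
  apply: ler_pM => //; apply: (le_trans qb); lra.
(* The unperturbed value is split off; the change of the corrector costs 32 and the change of the
   power costs 13, both in units of [K |t| / |sin (2 * theta)|], which fits into 47. *)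
have -> : (1 + K * g') * q = q + K * g + (K * ((g' - g) * q) + K * (g * (q - 1))).
  by ring.
have E4 : K * ((g' - g) * q) + K * (g * (q - 1)) <=
    47 * K * `|t| / `|sin (2 * theta)|.
  rewrite -mulrDr [47 * K]mulrC -!mulrA ler_wpM2l// !mulrA.
  have := divr_ge0 m0 (ltW D0); lra.
lra.
Qed.

(** * The one-step inequality for the potential *)

Definition nsq (R : realType) (u : R * R) : R := u.1 ^+ 2 + u.2 ^+ 2.

(* In complex notation: multiplication by e^(-i theta), then w |-> w + t Im w
   with t = tau y. *)
Definition shear_step (R : realType) (theta tau : R) (u : R * R) (y : R)
    : R * R :=
  let w2 := u.2 * cos theta - u.1 * sin theta in
  (u.1 * cos theta + u.2 * sin theta + tau * y * w2, w2).

(** The arguments are [cos 2phi] and [sin 2phi] for the argument [phi] of [u], so only the direction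
    of [u] matters. At [u = 0] the convention [1 / 0 = 0] gives the value 1. *)
Definition potential (R : realType) (theta s K : R) (u : R * R) : R :=
  1 + K * corrector R theta s ((u.1 ^+ 2 - u.2 ^+ 2) / nsq R u)
                              (2 * u.1 * u.2 / nsq R u).

(** The pair [(C, S)] is the doubled angle between the rotation and the shear. The rotation is
    treated exactly by the coboundary identity, the shear up to cubic errors. *)
Lemma potential_shear_step (R : realType) (theta tau s K : R) (u : R * R) :
  0 < sin theta -> sin (2 * theta) != 0 -> 0 <= s <= 1 -> 0 <= K ->
  0 < nsq R u ->
  exists C S : R, [/\ C ^+ 2 + S ^+ 2 = 1,
    potential R theta s K u = 1 + K *
      (corrector R theta s C S + 2 * C - (s + 1) * (C ^+ 2 - S ^+ 2)) &
    forall y, `|tau * y| <= 230^-1 ->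
     0 < nsq R (shear_step R theta tau u y) /\
     potential R theta s K (shear_step R theta tau u y) *
      (nsq R (shear_step R theta tau u y) / nsq R u) `^ (- s) <=
     1 - s * (tau * y) * S
     + (tau * y) ^+ 2 * (s * (s + 1) / 2 * S ^+ 2 - s * (1 - C) / 2)
     + 5 * s * `|tau * y| ^+ 3 + K * corrector R theta s C S
     + 47 * K * `|tau * y| / `|sin (2 * theta)|].
Proof.
case: u => a b s0 s20 sI K0 p0.
pose w1 := a * cos theta + b * sin theta.
pose w2 := b * cos theta - a * sin theta.
set p := nsq R (a, b) in p0 *.
have e1 := cos2Dsin2 theta.
have pE : p = w1 ^+ 2 + w2 ^+ 2.
  transitivity (p * (cos theta ^+ 2 + sin theta ^+ 2)); first by rewrite e1 mulr1.
  by rewrite /p /nsq /w1 /w2 /=; ring.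
have pn0 : p != 0 by rewrite gt_eqF.
have c2 : cos (2 * theta) = cos theta ^+ 2 - sin theta ^+ 2.
  by rewrite mulr_natl mulr2n cosD -!expr2.
have s2 : sin (2 * theta) = 2 * sin theta * cos theta.
  by rewrite mulr_natl mulr2n sinD; ring.
pose C := (w1 ^+ 2 - w2 ^+ 2) / p; pose S := 2 * w1 * w2 / p.
have CS : C ^+ 2 + S ^+ 2 = 1.
  by rewrite /C /S pE; field; rewrite -pE.
exists C, S; split=> //.
  rewrite /potential -corrector_rot//; last by rewrite gt_eqF.
  congr (1 + K * corrector R theta s _ _); rewrite -/p /=;
    apply: (mulIf pn0); rewrite mulfVK//.
  - have -> : (C * cos (2 * theta) - S * sin (2 * theta)) * p =
       (w1 ^+ 2 - w2 ^+ 2) * cos (2 * theta) - 2 * w1 * w2 * sin (2 * theta).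
      by rewrite /C /S; field.
    transitivity ((a ^+ 2 - b ^+ 2) * (cos theta ^+ 2 + sin theta ^+ 2) ^+ 2).
      by rewrite e1 expr1n mulr1.
    by rewrite c2 s2 /w1 /w2; ring.
  - have -> : (S * cos (2 * theta) + C * sin (2 * theta)) * p =
       2 * w1 * w2 * cos (2 * theta) + (w1 ^+ 2 - w2 ^+ 2) * sin (2 * theta).
      by rewrite /C /S; field.
    transitivity (2 * a * b * (cos theta ^+ 2 + sin theta ^+ 2) ^+ 2).
      by rewrite e1 expr1n mulr1.
    by rewrite c2 s2 /w1 /w2; ring.
move=> z; set t := tau * z => t0.
have uE : shear_step R theta tau (a, b) z = (w1 + t * w2, w2) by [].
have H := shear_potential R theta s t K C S s0 s20 sI K0 CS t0; rewrite /= in H.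
set r := 1 + (t * S + t ^+ 2 * (1 - C) / 2) in H.
have rE : nsq R (w1 + t * w2, w2) = p * r.
  by rewrite /nsq /r /C /S pE /=; field; rewrite -pE.
have r0 : 0 < r.
  have := shear_ratio_bound R t C S CS.
  have : `|t| ^+ 2 <= 230^-1 * `|t| by rewrite expr2 ler_wpM2r.
  rewrite /r => h1 /ler_normlP[h2 h3]; clear -h1 h2 t0; lra.
have rn0 : r != 0 by rewrite gt_eqF.
rewrite uE rE; split; first by rewrite mulr_gt0.
rewrite [p * r]mulrC mulfK//; apply: le_trans H.
rewrite le_eqVlt; apply/orP; left; apply/eqP; congr (_ * _).
rewrite /potential rE; congr (1 + K * corrector R theta s _ _) => /=.
  apply: (mulIf (mulf_neq0 pn0 rn0)); rewrite mulfVK ?mulf_neq0//.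
  rewrite [p * r]mulrC mulrA mulfVK// /C /S pE; field; by rewrite -pE.
apply: (mulIf (mulf_neq0 pn0 rn0)); rewrite mulfVK ?mulf_neq0//.
rewrite [p * r]mulrC mulrA mulfVK// /C /S pE; field; by rewrite -pE.
Qed.

(** The corrector is at most [12 / |sin (2 * theta)|], hence [K] times it is at most [1/3]. The
    quotient of the two bounds is the factor 2 of the final estimate. *)
Lemma potential_bound (R : realType) (theta s K : R) (u : R * R) :
  0 < sin theta -> sin (2 * theta) != 0 -> 0 <= s <= 1 -> 0 <= K ->
  36 * K <= `|sin (2 * theta)| ->
  2 / 3 <= potential R theta s K u <= 4 / 3.
Proof.
move=> s0 s20 sI K0 KD.
have D0 : 0 < `|sin (2 * theta)| by rewrite normr_gt0.
have [n0|pn0] := eqVneq (nsq R u) 0.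
  have -> : potential R theta s K u = 1.
    by rewrite /potential n0 invr0 !mulr0 /corrector; ring.
  by apply/andP; split; lra.
have xy : ((u.1 ^+ 2 - u.2 ^+ 2) / nsq R u) ^+ 2
          + (2 * u.1 * u.2 / nsq R u) ^+ 2 = 1.
  by move: pn0; rewrite /nsq => pn0; field.
have := corrector_bound R theta s _ _ s0 s20 sI (normr_le1_circle R _ _ xy).
rewrite addrC in xy; move=> /(_ _ (normr_le1_circle R _ _ xy)).
rewrite /potential; set g := corrector _ _ _ _ _ => gb.
have : `|K * g| <= 3^-1.
  rewrite normrM (ger0_norm K0); apply: (le_trans (ler_wpM2l K0 gb)).
  by rewrite mulrA ler_pdivrMr//; lra.
by rewrite ler_norml => /andP[h1 h2]; clear -h1 h2; apply/andP; split; lra.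
Qed.

Lemma corrector_weight_bound (R : realType) (theta tau c0 h s : R) :
  sin (2 * theta) != 0 -> 1 <= c0 -> 0 < tau ->
  h = c0 ^+ 3 * tau / `|sin (2 * theta)| -> h <= 230^-1 -> s <= 1 ->
  36 * (tau ^+ 2 * s / 4) <= `|sin (2 * theta)|.
Proof.
move=> s20 c1 t0 hE h230 s1.
have D0 : 0 < `|sin (2 * theta)| by rewrite normr_gt0.
have D1 : `|sin (2 * theta)| <= 1 by rewrite ler_norml sin_geN1 sin_le1.
have tD : tau <= 230^-1 * `|sin (2 * theta)|.
  apply: (@le_trans _ _ (h * `|sin (2 * theta)|)); last by rewrite ler_pM2r.
  by rewrite hE divfK ?gt_eqF// ler_peMl ?exprn_ege1// ltW.
have t1 : tau <= 1 by move: tD D1; clear; lra.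
have : tau ^+ 2 <= 230^-1 * `|sin (2 * theta)|.
  by apply: le_trans tD; rewrite expr2 ler_piMl ?(ltW t0).
have : tau ^+ 2 * s <= tau ^+ 2 by rewrite ler_piMr// sqr_ge0.
by move: D0; clear; lra.
Qed.

(** A majorant quadratic in the noise is enough: with mean 0 and variance 1 it integrates to
    [A + E]. The parameter [h] measures the cubic errors relative to [tau ^+ 2]. *)
Lemma potential_step_quadratic (R : realType) (theta tau c0 kappa h s K : R)
    (u : R * R) :
  0 < sin theta -> sin (2 * theta) != 0 -> 1 <= c0 -> 0 < tau ->
  h = c0 ^+ 3 * tau / `|sin (2 * theta)| -> h <= 230^-1 ->
  s = 1 - 115 * h -> K = tau ^+ 2 * s / 4 ->
  0 <= kappa <= 3 / 4 * (h * tau ^+ 2) ->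
  0 < nsq R u ->
  exists A B E : R, A + E <= potential R theta s K u /\
    forall y, `|y| <= c0 ->
      0 < nsq R (shear_step R theta tau u y) /\
      potential R theta s K (shear_step R theta tau u y) *
      (nsq R (shear_step R theta tau u y) / nsq R u) `^ (- s) *
      expR (s * kappa) <= A + B * y + E * y ^+ 2.
Proof.
move=> s0 s20 c1 t0 hE h230 sE KE /andP[k0 k1] p0.
have D0 : 0 < `|sin (2 * theta)| by rewrite normr_gt0.
have D1 : `|sin (2 * theta)| <= 1 by rewrite ler_norml sin_geN1 sin_le1.
have h0 : 0 < h.
  by rewrite hE divr_gt0// mulr_gt0// exprn_gt0//; apply: lt_le_trans c1.
have [s1 s2] : 2^-1 <= s /\ s <= 1 by clear -sE h230 h0; split; lra.
have s3 : 0 <= s by clear -s1; lra.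
have K0 : 0 < K.
  by rewrite KE divr_gt0// mulr_gt0// ?exprn_gt0//; clear -s1; lra.
have ctD : c0 * tau / `|sin (2 * theta)| <= h.
  rewrite hE ler_pM2r ?invr_gt0// ler_pM2r//.
  by apply: ler_eXnr.
have ct : c0 * tau <= h.
  apply: le_trans ctD; rewrite ler_pdivlMr// ler_piMr// mulr_ge0// ?ltW//.
  exact: lt_le_trans c1.
have K36 : 36 * K <= `|sin (2 * theta)|.
  by rewrite KE; apply: corrector_weight_bound hE h230 s2.
have [|C [S [CS fE step]]] := potential_shear_step R theta tau s K u s0 s20 _ (ltW K0) p0.
  by rewrite s3.
have := potential_bound R theta s K u s0 s20 _ (ltW K0) K36.
rewrite s3 s2 => /(_ isT) /andP[f1 f2].
set f := potential R theta s K u in fE f1 f2 *.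
set g := corrector R theta s C S in fE step.
pose e := expR (s * kappa); pose Q := s * (s + 1) / 2 * S ^+ 2 - s * (1 - C) / 2.
(* The cubic term becomes quadratic through [|tau y|^3 <= h (tau y)^2], and the error of the
   corrector becomes constant through [|tau y| / |sin (2 * theta)| <= h]. *)
exists (e * (1 + K * g + 47 * K * h)), (e * - (s * tau * S)),
  (e * (tau ^+ 2 * (Q + 5 * s * h))); split.
  (* The oscillating terms cancel against [f], leaving [K (s - 1 + 47 h + 20 h)]; with
     [s - 1 = - 115 h] this is [- 48 K h]. The factor [e] costs at most [4 K h] of it, because
     [s kappa <= 3 K h] and [f <= 4/3]. *)
  have -> : e * (1 + K * g + 47 * K * h) + e * (tau ^+ 2 * (Q + 5 * s * h)) =
      e * (f - 48 * (K * h)).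
    have S2 : S ^+ 2 = 1 - C ^+ 2 by rewrite -CS addrC addKr.
    rewrite fE -mulrDr; congr (_ * _).
    have -> : tau ^+ 2 * (Q + 5 * s * h) =
       K * (-2 + 2 * C + 2 * (s + 1) * S ^+ 2 + 20 * h).
      by rewrite KE /Q; field.
    by rewrite S2 sE; ring.
  have sk : s * kappa <= 3 * (K * h).
    have := ler_wpM2l s3 k1; rewrite KE; clear; lra.
  have sk0 : 0 <= s * kappa by apply: mulr_ge0.
  have e0 : 0 < e by apply: expR_gt0.
  have eN : 1 - s * kappa <= e^-1.
    by rewrite /e -expRN; apply: expR_ge1Dx.
  rewrite -[leRHS](mulVKf (lt0r_neq0 e0)) ler_pM2l// [leRHS]mulrC.
  have f0 : 0 <= f by clear -f1; lra.
  apply: le_trans (ler_wpM2l f0 eN).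
  have : f * (s * kappa) <= 4 / 3 * (s * kappa) by rewrite ler_wpM2r.
  have : 0 <= K * h by rewrite mulr_ge0// ltW.
  by clear -sk; lra.
move=> y yc.
have tyc : `|tau * y| <= tau * c0 by rewrite normrM (gtr0_norm t0) ler_wpM2l// ltW.
have tyh : `|tau * y| <= h by apply: le_trans tyc _; rewrite mulrC.
have [p1 {}step] := step y (le_trans tyh h230); split=> //.
rewrite mulrC -/e.
have -> : e * (1 + K * g + 47 * K * h) + e * - (s * tau * S) * y +
    e * (tau ^+ 2 * (Q + 5 * s * h)) * y ^+ 2 =
    e * (1 - s * (tau * y) * S + (tau * y) ^+ 2 * Q +
    5 * s * (h * (tau * y) ^+ 2) + K * g + 47 * K * h) by ring.
rewrite ler_pM2l ?expR_gt0//; apply: (le_trans step).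
rewrite -/Q lerD//; first rewrite lerD2r lerD2l ler_wpM2l ?mulr_ge0//.
  rewrite exprS -normrX (ger0_norm (sqr_ge0 (tau * y))).
  by rewrite ler_wpM2r ?sqr_ge0.
have K47 : 0 <= 47 * K by rewrite mulr_ge0// ltW.
rewrite -[leLHS]mulrA; apply: (ler_wpM2l K47); apply: (le_trans _ ctD).
by rewrite ler_pM2r ?invr_gt0// [c0 * _]mulrC.
Qed.

(** * From transfer matrices to the planar orbit *)

Lemma det_mx2 (R : comRingType) (A : 'M[R]_2) :
  \det A = A 0 0 * A 1 1 - A 0 1 * A 1 0.
Proof.
rewrite (expand_det_row _ 0) !big_ord_recl big_ord0 addr0 /cofactor.
rewrite !det_mx11 !mxE /= expr0 expr1 mul1r mulN1r mulrN.
congr (A _ _ * A _ _ - A _ _ * A _ _); exact: val_inj.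
Qed.

Lemma invmx2_det1 (R : comUnitRingType) (A : 'M[R]_2) : \det A = 1 ->
  [/\ invmx A 0 0 = A 1 1, invmx A 0 1 = - A 0 1,
      invmx A 1 0 = - A 1 0 & invmx A 1 1 = A 0 0].
Proof.
move=> d1; have uA : A \in unitmx by rewrite unitmxE d1 unitr1.
pose B : 'M[R]_2 := \matrix_(i, j) (if i == 0 then (if j == 0 then A 1 1 else - A 0 1)
  else (if j == 0 then - A 1 0 else A 0 0)).
have AB : A *m B = 1%:M.
  rewrite det_mx2 in d1.
  apply/matrixP => i j; rewrite !mxE !big_ord_recl big_ord0 !mxE /= addr0.
  have -> : lift ord0 ord0 = 1 :> 'I_2 by exact: val_inj.
  rewrite -[ord0]/(0 : 'I_2).
  have ord2 (k : 'I_2) : k = 0 \/ k = 1.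
    by case: k => [[|[|//]] hk]; [left|right]; apply: val_inj.
  have [->|->] := ord2 i; have [->|->] := ord2 j; rewrite /= mulrN.
  - by [].
  - by rewrite mulrC [A 0 1 * _]mulrC [_ * A 0 1]mulrC addNr.
  - by rewrite [A 1 1 * _]mulrC subrr.
  - by rewrite addrC mulrC [A 1 0 * _]mulrC.
have -> : invmx A = B by rewrite -[LHS]mulmx1 -AB mulKmx.
by rewrite /B !mxE.
Qed.

Lemma Im_divc (R : rcfType) (x y : R[i]) :
  complex.Im (x / y) = (complex.Im x * complex.Re y - complex.Re x * complex.Im y)
     / (complex.Re y ^+ 2 + complex.Im y ^+ 2).
Proof. by case: x => a b; case: y => c e /=; ring. Qed.

Lemma transferE (R : rcfType) (l s o : R) : let A := transfer l s o in
  [/\ A 0 0 = l - s * o, A 0 1 = -1, A 1 0 = 1 & A 1 1 = 0].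
Proof. by rewrite /= /transfer !mxE. Qed.

Lemma mulmx2E (R : pzSemiRingType) (A B : 'M[R]_2) i j :
  (A *m B) i j = A i 0 * B 0 j + A i 1 * B 1 j.
Proof.
rewrite !mxE !big_ord_recl big_ord0 addr0.
by have -> : lift ord0 ord0 = 1 :> 'I_2 by exact: val_inj.
Qed.

Lemma det_Wprod (R : rcfType) (l s : R) (om : nat -> R) k :
  \det (Wprod l s om k) = 1.
Proof.
elim: k => [|k IH]; first by rewrite det1.
rewrite /= det_mulmx IH mulr1 det_mx2.
by have [-> -> -> ->] := transferE R l s (om k.+1); rewrite mulr0 mulN1r sub0r opprK.
Qed.

Fixpoint orbit_vec (R : realType) (theta tau : R) (om : nat -> R) (k : nat) : R * R :=
  if k is k'.+1 then shear_step R theta tau (orbit_vec R theta tau om k') (om k)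
  else (1, 0).

(** With [u = W 0 0 - W 1 0 * z], one transfer matrix gives [conj z * u - sigma omega W 0 0]. Since
    [Im (conj z * u) = - W 0 0 * sin theta], the perturbation is exactly a shear with
    [t = sigma omega / sin theta]. *)
Lemma orbit_vecE (R : realType) (theta sigma : R) (om : nat -> R) k :
  sin theta != 0 ->
  let W := Wprod (2 * cos theta) sigma om k in
  orbit_vec R theta (sigma / sin theta) om k =
  (W 0 0 - W 1 0 * cos theta, - (W 1 0 * sin theta)).
Proof.
move=> s0 /=; elim: k => [|k IH].
  by rewrite /= !mxE /= !mul0r subr0 oppr0.
rewrite /= IH; set W := Wprod _ _ _ k.
rewrite !mulmx2E; have [-> -> -> ->] := transferE R (2 * cos theta) sigma (om k.+1).
rewrite /shear_step /=; congr (_, _); last by ring.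
have -> : sigma / sin theta * om k.+1 * (- (W 1 0 * sin theta) * cos theta -
   (W 0 0 - W 1 0 * cos theta) * sin theta) = - (sigma * om k.+1 * W 0 0).
  by field.
apply/eqP; rewrite -subr_eq0; set X := _ - _.
have -> : X = W 1 0 * (1 - (cos theta ^+ 2 + sin theta ^+ 2)) by rewrite /X; ring.
by rewrite cos2Dsin2 subrr mulr0.
Qed.

(** The determinant is 1, so the inverse is the adjugate, and the usual formula for the imaginary
    part of a Moebius image has denominator [|W 0 0 - W 1 0 * z|^2]. *)
Lemma Yk_nsq (R : realType) (theta sigma : R) (om : nat -> R) k :
  sin theta != 0 ->
  Yk theta sigma om k =
  sin theta / nsq R (orbit_vec R theta (sigma / sin theta) om k).
Proof.
move=> s0; rewrite orbit_vecE// /Yk /mobius.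
have d1 := det_Wprod R (2 * cos theta) sigma om k.
set W := Wprod _ _ _ _ in d1 *.
have [-> -> -> ->] := invmx2_det1 R W d1.
rewrite det_mx2 in d1; rewrite Im_divc /nsq /=.
congr (_ / _); last by ring.
rewrite -[RHS]mulr1 -d1; ring.
Qed.

(** * Independence and supermartingales for chains driven by independent noise *)

(** As functions of [X], both sides are finite measures; they agree on rectangles, which are stable
    under intersection and generate the product sigma-algebra. *)
Lemma independent_pair_event d1 d2 d3 (T : measurableType d1)
    (E1 : measurableType d2) (E2 : measurableType d3) (R : realType)
    (P : probability T R) (f : T -> E1) (g : T -> E2) (F : set T) :
  measurable_fun setT f -> measurable_fun setT g -> measurable F ->
  (forall A B, measurable A -> measurable B ->
    P ((f @^-1` A `&` g @^-1` B) `&` F) = (P (f @^-1` A `&` g @^-1` B) * P F)%E) ->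
  forall X : set (E1 * E2), measurable X ->
    P ((fun x => (f x, g x)) @^-1` X `&` F) =
    (P ((fun x => (f x, g x)) @^-1` X) * P F)%E.
Proof.
move=> mf mg mF FE X mX.
have mfg : measurable_fun setT (fun x => (f x, g x)).
  exact: measurable_fun_pair.
have PFfin : P F \is a fin_num by rewrite fin_num_measure.
have p0 : (0 <= fine (P F))%R by rewrite fine_ge0.
pose fg : {mfun T >-> (E1 * E2)%type} := HB.pack (fun x => (f x, g x))
  (isMeasurableFun.Build _ _ _ _ (fun x => (f x, g x)) mfg).
pose m1' : {measure set (E1 * E2) -> \bar R} := pushforward (mrestr P mF) fg.
pose m1 := m1' mfg.
pose m2 : {measure set (E1 * E2) -> \bar R} :=
  mscale (NngNum p0) (distribution P fg).
have m2E (Y : set (E1 * E2)) : m2 Y = (P ((fun x => (f x, g x)) @^-1` Y) * P F)%E.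
  by rewrite /m2 /= /mscale /= fineK// muleC.
rewrite -m2E -[LHS]/(m1 X).
pose G : set (set (E1 * E2)) :=
  [set C | exists2 A, measurable A & exists2 B, measurable B & A `*` B = C].
apply: (measure_unique G (fun=> setT)) => //.
- by rewrite measurable_prod_measurableType.
- move=> _ _ [A mA [B mB <-]] [A' mA' [B' mB' <-]].
  rewrite -setXI; exists (A `&` A'); first exact: measurableI.
  by exists (B `&` B') => //; exact: measurableI.
- by move=> n; exists setT => //; exists setT => //; rewrite setXTT.
- by rewrite bigcup_const.
- by move=> _ [A mA [B mB <-]]; rewrite m2E -FE.
- by move=> n; rewrite /m1 /m1' /= /pushforward /= /mrestr preimage_setT setTI ltey_eq PFfin.
Qed.

(** The joint law is the product of the marginal laws, so Tonelli applies. This plays the role of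
    conditioning on [f]. *)
Lemma integral_independent_pair d1 d2 d3 (T : measurableType d1)
    (E1 : measurableType d2) (E2 : measurableType d3) (R : realType)
    (P : probability T R) (f : T -> E1) (g : T -> E2) (h : E1 * E2 -> \bar R) :
  measurable_fun setT f -> measurable_fun setT g -> measurable_fun [set: E1 * E2] h ->
  (forall z, 0 <= h z)%E ->
  (forall A B, measurable A -> measurable B ->
    P (f @^-1` A `&` g @^-1` B) = (P (f @^-1` A) * P (g @^-1` B))%E) ->
  (\int[P]_x h (f x, g x) = \int[P]_x \int[P]_y h (f x, g y))%E.
Proof.
move=> mf mg mh h0 ind.
have mfg : measurable_fun setT (fun x => (f x, g x)).
  exact: measurable_fun_pair.
pose f' : {mfun T >-> E1} := HB.pack f (isMeasurableFun.Build _ _ _ _ f mf).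
pose g' : {mfun T >-> E2} := HB.pack g (isMeasurableFun.Build _ _ _ _ g mg).
pose fg : {mfun T >-> (E1 * E2)%type} := HB.pack (fun x => (f x, g x))
  (isMeasurableFun.Build _ _ _ _ (fun x => (f x, g x)) mfg).
rewrite -[LHS]/(\int[P]_x (h \o fg) x)%E.
rewrite -(@ge0_integral_distribution _ _ _ _ _ P fg)//.
rewrite (eq_measure_integral (distribution P f' \x distribution P g')%E).
  rewrite fubini_tonelli1// /fubini_F.
  rewrite (@ge0_integral_distribution _ _ _ _ _ P f'); last 2 first.
  - exact: measurable_fun_fubini_tonelli_F.
  - by move=> x; apply: integral_ge0.
  apply: eq_integral => x _ /=.
  rewrite (@ge0_integral_distribution _ _ _ _ _ P g')//.
  exact: measurableT_comp.
move=> A mA _; apply/esym; apply: product_measure_unique => // B C mB mC.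
Qed.

Lemma mutually_independent_cons d (T : measurableType d) (R : realType)
    (P : probability T R) (X : nat -> T -> R) (j : nat) (I : seq nat)
    (C : set R) (B : nat -> set R) :
  mutually_independent P X -> uniq I -> j \notin I -> measurable C ->
  (forall i, measurable (B i)) ->
  P (X j @^-1` C `&` \bigcap_(i in [set` I]) (X i @^-1` B i)) =
  (P (X j @^-1` C) * P (\bigcap_(i in [set` I]) (X i @^-1` B i)))%E.
Proof.
move=> ind uI jI mC mB.
pose B' i := if i == j then C else B i.
have B'I i : i \in I -> B' i = B i.
  by rewrite /B'; case: eqP => // -> h; rewrite h in jI.
have -> : X j @^-1` C `&` \bigcap_(i in [set` I]) (X i @^-1` B i) =
    \bigcap_(i in [set` (j :: I)]) (X i @^-1` B' i).
  apply/seteqP; split => [x [xC xI] i /= | x xI].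
    rewrite inE => /orP[/eqP ->|iI]; first by rewrite /B' eqxx.
    by rewrite B'I//; exact: xI.
  split => [|i /= iI].
    by have := xI j; rewrite /= mem_head /B' eqxx; apply.
  by have := xI i; rewrite /= inE iI orbT B'I//; apply.
rewrite ind//=; [|by rewrite jI|by move=> i; rewrite /B'; case: eqP].
rewrite big_cons /B' eqxx; congr (_ * _)%E.
rewrite ind//; apply: eq_big_seq => i iI; case: eqP => // ij.
by rewrite -ij iI in jI.
Qed.

(** In the uses below [S0] is a function of [om 0], so the state at time [n] depends on [om 0] to
    [om n] only. *)
Fixpoint driven_chain (T E U : Type) (S0 : T -> E) (step : E -> U -> E)
    (om : nat -> T -> U) (n : nat) (x : T) : E :=
  if n is m.+1 then step (driven_chain T E U S0 step om m x) (om n x) else S0 x.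

Lemma measurable_driven_chain d d' (T : measurableType d)
    (E : measurableType d') (R : realType) (S0 : T -> E) (step : E -> R -> E)
    (om : nat -> T -> R) (n : nat) :
  measurable_fun setT S0 ->
  measurable_fun [set: E * R] (fun z => step z.1 z.2) ->
  (forall j, measurable_fun setT (om j)) ->
  measurable_fun setT (driven_chain T E R S0 step om n).
Proof.
move=> mS0 mstep mom; elim: n => //= n IH.
have mp : measurable_fun setT (fun x => (driven_chain T E R S0 step om n x, om n.+1 x)).
  exact: measurable_fun_pair.
exact: (measurableT_comp mstep mp).
Qed.

(** Independence of past and future, with future events described by finite lists [I]. Induction on
    [n] for all lists at once: a rectangle for [(S n, om n.+1)] is handled by moving the condition
    on [om n.+1] into the list. *)
Lemma driven_chain_independent d d' (T : measurableType d)
    (E : measurableType d') (R : realType) (P : probability T R)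
    (om : nat -> {RV P >-> R}) (phi : R -> E) (step : E -> R -> E)
    (n : nat) (I : seq nat) (A : set E) (B : nat -> set R) :
  mutually_independent P (fun j => om j : T -> R) ->
  measurable_fun setT phi ->
  measurable_fun [set: E * R] (fun z => step z.1 z.2) ->
  uniq I -> (forall i, i \in I -> (n < i)%N) ->
  measurable A -> (forall i, measurable (B i)) ->
  let S := driven_chain T E R (phi \o om 0%N) step (fun j => om j) in
  P (S n @^-1` A `&` \bigcap_(i in [set` I]) (om i @^-1` B i)) =
  (P (S n @^-1` A) * P (\bigcap_(i in [set` I]) (om i @^-1` B i)))%E.
Proof.
move=> ind mphi mstep uI nI mA mB S.
have mS k : measurable_fun setT (S k).
  apply: measurable_driven_chain => //; exact: measurableT_comp.
have mF (J : seq nat) (B' : nat -> set R) : (forall i, measurable (B' i)) ->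
    measurable (\bigcap_(i in [set` J]) (om i @^-1` B' i)).
  move=> mB'; apply: fin_bigcap_measurable => // i _.
  exact: measurable_funPTI.
elim: n I A B uI nI mA mB => [|n IH] I A B uI nI mA mB.
  have mA0 : measurable (phi @^-1` A) by rewrite -[X in measurable X]setTI; exact: mphi.
  apply: (mutually_independent_cons _ _ _ P (fun j => om j : T -> R) 0 I (phi @^-1` A) B) => //.
  by apply/negP => /nI.
have nin : n.+1 \notin I by apply/negP => /nI; rewrite ltnn.
have mstepA : measurable ((fun z : E * R => step z.1 z.2) @^-1` A).
  by rewrite -[X in measurable X]setTI; exact: mstep.
apply: (independent_pair_event _ _ _ T E R R P (S n) (om n.+1)
  (\bigcap_(i in [set` I]) (om i @^-1` B i)) (mS n) _ _ _ _ mstepA) => //.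
  exact: mF.
move=> A' B' mA' mB'.
have IHn : P (S n @^-1` A' `&` om n.+1 @^-1` B') =
    (P (S n @^-1` A') * P (om n.+1 @^-1` B'))%E.
  have := IH [:: n.+1] A' (fun=> B'); rewrite set_cons1 bigcap_set1; apply => //.
  by move=> i; rewrite inE => /eqP ->.
rewrite IHn -setIA -muleA -(mutually_independent_cons _ _ _ _ (fun j => om j : T -> R))//.
have := IH (n.+1 :: I) A' (fun i => if i == n.+1 then B' else B i).
have -> : \bigcap_(i in [set` (n.+1 :: I)])
   (om i @^-1` (if i == n.+1 then B' else B i)) =
   om n.+1 @^-1` B' `&` \bigcap_(i in [set` I]) (om i @^-1` B i).
  apply/seteqP; split => [x xI|x [xC xI] i /=].
    split => [|i /= iI]; first by have := xI n.+1; rewrite /= mem_head eqxx; apply.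
    have := xI i; rewrite /= inE iI orbT; case: eqP => [e|_]; last exact.
    by rewrite -e iI in nin.
  rewrite inE => /orP[/eqP ->|iI]; first by rewrite eqxx.
  case: eqP => [e|_]; last exact: xI.
  by rewrite -e iI in nin.
apply => //=; first by rewrite nin.
- by move=> i; rewrite inE => /orP[/eqP -> //|/nI /ltnW].
- by move=> i; case: eqP.
Qed.

(** By independence the next noise can be integrated with the current state held fixed, and there
    the one-step hypothesis applies. *)
Lemma driven_chain_supermartingale d d' (T : measurableType d)
    (E : measurableType d') (R : realType) (P : probability T R)
    (om : nat -> {RV P >-> R}) (phi : R -> E) (step : E -> R -> E)
    (V : E -> \bar R) (n : nat) :
  mutually_independent P (fun j => om j : T -> R) ->
  measurable_fun setT phi ->
  measurable_fun [set: E * R] (fun z => step z.1 z.2) ->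
  measurable_fun setT V -> (forall e, 0 <= V e)%E ->
  (forall e j, \int[P]_x V (step e (om j x)) <= V e)%E ->
  (\int[P]_x V (driven_chain T E R (phi \o om 0%N) step (fun j => om j) n x)
   <= \int[P]_x V (phi (om 0%N x)))%E.
Proof.
move=> ind mphi mstep mV V0 Vstep.
pose S := driven_chain T E R (phi \o om 0%N) step (fun j => om j).
have mS k : measurable_fun setT (S k).
  apply: measurable_driven_chain => //; exact: measurableT_comp.
elim: n => // n IH; apply: le_trans IH; rewrite -[X in (_ <= X)%E]/(\int[P]_x V (S n x))%E.
have mVs : measurable_fun [set: E * R] (fun z => V (step z.1 z.2)).
  exact: (measurableT_comp mV mstep).
rewrite [leLHS](integral_independent_pair _ _ _ T E R R P (S n) (om n.+1)
  (fun z => V (step z.1 z.2)))//=; last first.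
  move=> A B mA mB.
  have := driven_chain_independent _ _ T E R P om phi step n [:: n.+1] A (fun=> B).
  rewrite /= set_cons1 bigcap_set1; apply => //.
  by move=> i; rewrite inE => /eqP ->.
apply: ge0_le_integral => //.
- by move=> x _; apply: integral_ge0.
(* Measurability of the inner integral: it is a partial integral against the law of [om n.+1],
   composed with the state. *)
- rewrite (_ : (fun x => _) =
      fubini_F (distribution P (om n.+1)) (fun z => V (step z.1 z.2)) \o S n).
    apply: measurableT_comp => //.
    by apply: measurable_fun_fubini_tonelli_F.
  apply/funext => x; rewrite /= /fubini_F ge0_integral_distribution//.
  exact: (measurableT_comp mVs (measurable_pair1 (S n x))).
- exact: measurableT_comp.
Qed.

(** * The stopped chain and its supermartingale *)

Lemma nsq_ge0 (R : realType) (u : R * R) : 0 <= nsq R u.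
Proof. by rewrite addr_ge0 ?sqr_ge0. Qed.

Lemma nsq_shear_step_gt0 (R : realType) (theta tau : R) (u : R * R) (y : R) :
  0 < nsq R u -> 0 < nsq R (shear_step R theta tau u y).
Proof.
move=> u0; rewrite lt_neqAle nsq_ge0 andbT eq_sym; apply: contraTneq u0.
rewrite -leNgt /nsq /= => /eqP.
rewrite paddr_eq0 ?sqr_ge0// !sqrf_eq0 => /andP[/eqP h1 /eqP h2].
rewrite h2 mulr0 addr0 in h1.
rewrite -[leLHS]mulr1 -(cos2Dsin2 theta).
have -> : (u.1 ^+ 2 + u.2 ^+ 2) * (cos theta ^+ 2 + sin theta ^+ 2) =
  (u.1 * cos theta + u.2 * sin theta) ^+ 2 +
  (u.2 * cos theta - u.1 * sin theta) ^+ 2 by ring.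
by rewrite h1 h2 expr0n /= addr0.
Qed.

Lemma integral_le_quadratic d (T : measurableType d) (R : realType)
    (P : probability T R) (X : {RV P >-> R}) (f : R -> R) (a b c c0 : R) :
  measurable_fun setT f -> (forall y, 0 <= f y) ->
  ('E_P[X] = 0)%E -> ('E_P[(fun x => X x ^+ 2)%R] = 1)%E ->
  {ae P, forall x, `|X x| < c0} ->
  (forall y, `|y| < c0 -> f y <= a + b * y + c * y ^+ 2) ->
  (\int[P]_x (f (X x))%:E <= (a + c)%:E)%E.
Proof.
move=> mf f0 E1 E2 Xc fq.
have mX : measurable_fun setT (X : T -> R) by [].
have iX : P.-integrable setT (EFin \o X).
  apply/integrableP; split; first exact/measurable_EFinP.
  apply: (@le_lt_trans _ _ (\int[P]_x (cst `|c0|%:E x))%E).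
    apply: ae_ge0_le_integral => //.
    - by apply: measurableT_comp => //; exact/measurable_EFinP.
    - by move=> x _; rewrite lee_fin.
    - apply: filterS Xc => x xc _; rewrite /= lee_fin.
      by rewrite (le_trans (ltW xc))// ler_norm.
  by rewrite integral_cst//= [P setT]probability_setT mule1 ltry.
have iX2 : P.-integrable setT (EFin \o (fun x => X x ^+ 2)).
  apply/integrableP; split; first exact/measurable_EFinP/measurable_funX.
  rewrite (_ : (\int[P]_x _ = 1)%E) ?ltry// -E2 unlock.
  by apply: eq_integral => x _ /=; rewrite ger0_norm// sqr_ge0.
have mq : measurable_fun setT (fun x => a + b * X x + c * X x ^+ 2).
  apply: measurable_funD; first by apply: measurable_funD => //; exact: measurable_funM.
  by apply: measurable_funM => //; exact: measurable_funX.
have -> : ((a + c)%:E = \int[P]_x (a + b * X x + c * X x ^+ 2)%:E)%E.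
  have ia : P.-integrable setT (EFin \o cst a).
    exact: finite_measure_integrable_cst.
  have ib : P.-integrable setT (fun x => b%:E * (X x)%:E)%E by exact: integrableZl.
  have ic : P.-integrable setT (fun x => c%:E * (X x ^+ 2)%:E)%E by exact: integrableZl.
  under eq_integral do rewrite !EFinD !EFinM.
  rewrite integralD//; last exact: integrableD.
  rewrite integralD// integralZl// integralZl//.
  move: E1 E2; rewrite unlock => -> ->.
  by rewrite integral_cst//= [P setT]probability_setT !mule1 mule0 adde0.
(* The quadratic is known to be nonnegative only almost surely; its absolute value has the same
   integral and is nonnegative everywhere, as the comparison of integrals requires. *)
have -> : (\int[P]_x (a + b * X x + c * X x ^+ 2)%:E =
    \int[P]_x `|a + b * X x + c * X x ^+ 2|%:E)%E.
  apply: ae_eq_integral => //.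
  - exact/measurable_EFinP.
  - by apply/measurable_EFinP; apply: measurableT_comp.
  apply: filterS Xc => x xc _; rewrite /= ger0_norm//.
  exact: le_trans (f0 _) (fq _ xc).
have mfX : measurable_fun setT (fun x => (f (X x))%:E).
  by apply/measurable_EFinP; apply: measurableT_comp.
have mqX : measurable_fun setT (fun x => `|a + b * X x + c * X x ^+ 2|%:E).
  by apply/measurable_EFinP; apply: measurableT_comp.
apply: (ae_ge0_le_integral measurableT _ mfX _ mqX).
- by move=> x _; rewrite lee_fin f0.
- by move=> x _; rewrite lee_fin normr_ge0.
apply: filterS Xc => x xc _; rewrite lee_fin.
exact: le_trans (fq _ xc) (ler_norm _).
Qed.

(* The chain (u, l) records the orbit vector u and l = log Y_n - log Y_1 +
   kappa (n - 1), frozen once l has reached B.  The test on nsq u is vacuous along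
   the orbit; it makes the one-step inequality true for every state. *)
Definition stopped_step (R : realType) (theta tau kappa B : R)
    (e : (R * R) * R) (y : R) : (R * R) * R :=
  if (B <= e.2) || (nsq R e.1 <= 0) then e else
  let v := shear_step R theta tau e.1 y in
  (v, e.2 - (ln (nsq R v) - ln (nsq R e.1)) + kappa).

(** Until the chain freezes, the exponential is the [s]-th power of [Y_n e^(kappa n)] relative to
    its value at time 1. *)
Definition weighted_potential (R : realType) (theta s K : R)
    (e : (R * R) * R) : R := potential R theta s K e.1 * expR (s * e.2).

Lemma measurable_nsq d (T : measurableType d) (R : realType) (f : T -> R * R) :
  measurable_fun setT f -> measurable_fun setT (fun x => nsq R (f x)).
Proof.
move=> mf; apply: measurable_funD; apply: measurable_funX.
  exact: (measurableT_comp measurable_fst mf).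
exact: (measurableT_comp measurable_snd mf).
Qed.

Lemma measurable_shear_step d (T : measurableType d) (R : realType)
    (theta tau : R) (f : T -> R * R) (g : T -> R) :
  measurable_fun setT f -> measurable_fun setT g ->
  measurable_fun setT (fun x => shear_step R theta tau (f x) (g x)).
Proof.
move=> mf mg.
have m1 : measurable_fun setT (fun x => (f x).1) by exact: (measurableT_comp measurable_fst mf).
have m2 : measurable_fun setT (fun x => (f x).2) by exact: (measurableT_comp measurable_snd mf).
have mw : measurable_fun setT
    (fun x => (f x).2 * cos theta - (f x).1 * sin theta).
  by apply: measurable_funB; apply: measurable_funM.
apply: measurable_fun_pair => //=.
apply: measurable_funD; last by apply: measurable_funM => //; exact: measurable_funM.
by apply: measurable_funD; apply: measurable_funM.
Qed.

Lemma measurable_stopped_step (R : realType) (theta tau kappa B : R) :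
  measurable_fun [set: ((R * R) * R) * R]
    (fun z => stopped_step R theta tau kappa B z.1 z.2).
Proof.
have mu : measurable_fun [set: ((R * R) * R) * R] (fun z => z.1.1).
  exact: (measurableT_comp measurable_fst measurable_fst).
have ml : measurable_fun [set: ((R * R) * R) * R] (fun z => z.1.2).
  exact: (measurableT_comp measurable_snd measurable_fst).
have mv := measurable_shear_step _ _ R theta tau _ _ mu measurable_snd.
apply: measurable_fun_ifT => //.
- apply: measurable_or; apply: measurable_fun_ler => //.
  exact: measurable_nsq.
apply: measurable_fun_pair => //.
apply: measurable_funD => //; apply: measurable_funB => //.
by apply: measurable_funB; apply: measurableT_comp => //; exact: measurable_nsq.
Qed.

Lemma measurable_weighted_potential (R : realType) (theta s K : R) :
  measurable_fun [set: (R * R) * R] (weighted_potential R theta s K).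
Proof.
have m1 : measurable_fun [set: (R * R) * R] (fun z => z.1.1).
  exact: (measurableT_comp measurable_fst measurable_fst).
have m2 : measurable_fun [set: (R * R) * R] (fun z => z.1.2).
  exact: (measurableT_comp measurable_snd measurable_fst).
(* The inverse is written as the power with exponent [-1]; the two agree on all nonnegative numbers,
   including 0. *)
have mp : measurable_fun [set: (R * R) * R] (fun z => (nsq R z.1)^-1).
  have mn := measurable_nsq _ _ R _ (measurable_fst : measurable_fun [set: (R * R) * R] fst).
  have := measurableT_comp (measurable_powR (-1)) mn.
  by congr measurable_fun; apply/funext => z /=; rewrite powR_inv1 ?nsq_ge0.
have mx : measurable_fun [set: (R * R) * R]
    (fun z => (z.1.1 ^+ 2 - z.1.2 ^+ 2) / nsq R z.1).
  by apply: measurable_funM => //; apply: measurable_funB; exact: measurable_funX.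
have my : measurable_fun [set: (R * R) * R]
    (fun z => 2 * z.1.1 * z.1.2 / nsq R z.1).
  by do 3 apply: measurable_funM => //.
apply: measurable_funM; last first.
  by apply: measurableT_comp => //; exact: measurable_funM.
apply: measurable_funD => //; apply: measurable_funM => //.
apply: measurable_funB.
  apply: measurable_funM => //; apply: measurable_funB; exact: measurable_funM.
apply: measurable_funM => //; apply: measurable_funB; apply: measurable_funM => //.
  by do 2 apply: measurable_funM => //.
by apply: measurable_funB; exact: measurable_funX.
Qed.

(** A frozen state gives equality. Otherwise [expR (s * e.2)] factors out and the quadratic majorant
    is integrated. *)
Lemma stopped_step_supermartingale d (T : measurableType d) (R : realType)
    (P : probability T R) (X : {RV P >-> R})
    (theta tau c0 kappa B h s K : R) (e : (R * R) * R) :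
  0 < sin theta -> sin (2 * theta) != 0 -> 1 <= c0 -> 0 < tau ->
  h = c0 ^+ 3 * tau / `|sin (2 * theta)| -> h <= 230^-1 ->
  s = 1 - 115 * h -> K = tau ^+ 2 * s / 4 ->
  0 <= kappa <= 3 / 4 * (h * tau ^+ 2) ->
  (forall u, 0 <= potential R theta s K u) ->
  ('E_P[X] = 0)%E -> ('E_P[(fun x => X x ^+ 2)%R] = 1)%E ->
  {ae P, forall x, `|X x| < c0} ->
  (\int[P]_x (weighted_potential R theta s K
     (stopped_step R theta tau kappa B e (X x)))%:E <=
   (weighted_potential R theta s K e)%:E)%E.
Proof.
move=> s0 s20 c1 t0 hE h230 sE KE kI f0 E1 E2 Xc.
have [stop|] := boolP ((B <= e.2) || (nsq R e.1 <= 0)).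
  rewrite (eq_integral (cst (weighted_potential R theta s K e)%:E)); last first.
    by move=> x _; rewrite /stopped_step stop.
  by rewrite integral_cst//= [P setT]probability_setT mule1.
move=> go; have := go; rewrite negb_or -!ltNge => /andP[_ p0].
have [A [b [c [Ac q]]]] := potential_step_quadratic R theta tau c0 kappa h s K e.1
  s0 s20 c1 t0 hE h230 sE KE kI p0.
pose E := expR (s * e.2).
apply: (@le_trans _ _ (E * A + E * c)%:E).
  apply: (integral_le_quadratic _ _ _ P X (fun y => weighted_potential R theta s K
    (stopped_step R theta tau kappa B e y)) _ (E * b) _ c0) => //.
  - apply: (measurableT_comp (measurable_weighted_potential _ _ _ _)).
    exact: (measurableT_comp (measurable_stopped_step _ _ _ _ _) (measurable_pair1 e)).
  - by move=> y; rewrite mulr_ge0 ?expR_ge0.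
  - move=> y /ltW yc; have [p1 qy] := q y yc.
    have -> : E * A + E * b * y + E * c * y ^+ 2 = E * (A + b * y + c * y ^+ 2) by ring.
    apply: le_trans (ler_wpM2l (expR_ge0 _) qy).
    rewrite /weighted_potential /stopped_step (negbTE go) /=.
    set v := shear_step _ _ _ _ _ in p1 *.
    rewrite /powR gt_eqF ?divr_gt0// ln_div ?posrE//.
    rewrite [X in _ <= X]mulrCA -mulrA -!expRD.
    rewrite le_eqVlt; apply/orP; left; apply/eqP; congr (_ * expR _); ring.
rewrite lee_fin -mulrDr mulrC /weighted_potential ler_wpM2r ?expR_ge0//.
Qed.

Lemma orbit_vec_gt0 (R : realType) (theta tau : R) (om : nat -> R) n :
  0 < nsq R (orbit_vec R theta tau om n).
Proof.
elim: n => [|n IH] /=; last exact: nsq_shear_step_gt0.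
by rewrite /nsq /= expr1n expr0n addr0.
Qed.

(** The chain only ever shows true values of the orbit, and the current one as long as it is below
    [B]; hence it reaches [B] exactly when the orbit does. It starts after the first noise, so time
    [n] of the chain is index [n.+1] of the orbit. *)
Lemma stopped_chain_orbit (T : Type) (R : realType) (theta tau kappa B : R)
    (om : nat -> T -> R) (x : T) (n : nat) : 0 < B ->
  let u := orbit_vec R theta tau (fun j => om j.-1 x) in
  let L k := ln (nsq R (u 1%N)) - ln (nsq R (u k.+1)) + kappa * k%:R in
  let S := driven_chain T _ R
    ((fun y => (shear_step R theta tau (1, 0) y, 0)) \o om 0%N)
    (stopped_step R theta tau kappa B) om in
  (exists k, S n x = (u k.+1, L k)) /\ ((S n x).2 < B -> S n x = (u n.+1, L n)).
Proof.
move=> B0 u L S; elim: n => [|n [[k Sk] Sn]].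
  have L0 : L 0%N = 0 by rewrite /L subrr mulr0 addr0.
  by split; [exists 0%N|]; rewrite L0.
have SE : S n.+1 x = stopped_step R theta tau kappa B (S n x) (om n.+1 x) by [].
have [stop|go] := boolP ((B <= (S n x).2) || (nsq R (S n x).1 <= 0)).
  rewrite SE /stopped_step stop; split; first by exists k.
  move: stop; rewrite Sk /= leNgt => /orP[/negP //|].
  by rewrite leNgt orbit_vec_gt0.
have e2 : S n.+1 x = (u n.+2, L n.+1).
  rewrite SE /stopped_step (negbTE go).
  move: go; rewrite negb_or -!ltNge => /andP[/Sn -> _] /=; congr (_, _).
  by rewrite /L -[shear_step _ _ _ _ _]/(u n.+2) -[n.+1%:R]natr1 mulrDr mulr1; ring.
by split=> //; exists n.+1.
Qed.

(** * The tail bound for all times *)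

(* omega_j (j >= 1) is represented by om j.-1, i.e. om : nat -> ... is the
   0-indexed sequence (omega_1, omega_2, ...). *)
Theorem theorem3 (R : realType) (d : measure_display) (T : measurableType d)
  (P : probability T R) (om : nat -> {RV P >-> R})
  (theta c0 sigma kappa B : R) :
  0 < theta < pi ->
  sin (2 * theta) != 0 ->
  mutually_independent P (fun j => om j : T -> R) ->
  identically_distributed P (fun j => om j : T -> R) ->
  (forall j, ('E_P[om j] = 0)%E) ->
  (forall j, ('E_P[(fun x => om j x ^+ 2)%R] = 1)%E) ->
  (forall j, {ae P, forall x, `|om j x| < c0}) ->
  0 < sigma <= 2 * sin theta * `|sin (2 * theta)| / (460 * c0 ^+ 3) ->
  0 <= kappa <= 6 * c0 ^+ 3 * (1 / (2 * sin theta)) ^+ 3 * sigma ^+ 3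
                 / `|sin (2 * theta)| ->
  0 < B ->
  (P [set x | exists n : nat, (1 <= n)%N /\
      ((ln (Yk theta sigma (fun j => om j.-1 x) n) + kappa * n%:R)
      - (ln (Yk theta sigma (fun j => om j.-1 x) 1) + kappa) >= B)%R]
   <= (2 * expR (- (B * (1 - 230 * c0 ^+ 3 * sigma
                        / (2 * sin theta * `|sin (2 * theta)|)))))%R%:E)%E.
Proof.
move=> /andP[th0 thpi] s20 ind _ E1 E2 omc /andP[sg0 sgI] /andP[k0 kI] B0.
have s0 : 0 < sin theta by apply: sin_gt0_pi; rewrite th0.
have D0 : 0 < `|sin (2 * theta)| by rewrite normr_gt0.
have sn0 : sin theta != 0 by rewrite gt_eqF.
have Dn0 : `|sin (2 * theta)| != 0 by rewrite gt_eqF.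
have c30 : 0 < c0 ^+ 3.
  have := lt_le_trans sg0 sgI.
  rewrite (pmulr_rgt0 _ (mulr_gt0 (mulr_gt0 (ltr0Sn R 1) s0) D0)) invr_gt0.
  by clear; lra.
have cp : 0 < c0 by move: c30; rewrite exprn_odd_gt0.
(* The variance is 1 and the noise is almost surely below [c0] in absolute value, so the constant
   majorant [c0 ^+ 2] of the square has integral at least 1. *)
have c2 : 1 <= c0 ^+ 2.
  rewrite -[leRHS]addr0 -lee_fin -(E2 0%N) unlock.
  apply: (integral_le_quadratic _ _ R P (om 0%N) (fun y => y ^+ 2) (c0 ^+ 2) 0 0 c0).
  - exact: measurable_funX.
  - by move=> y; rewrite sqr_ge0.
  - exact: E1.
  - exact: E2.
  - exact: omc.
  move=> y yc; rewrite !mul0r !addr0 -[leLHS]real_normK ?num_real//.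
  by rewrite lerXn2r ?nnegrE ?(ltW cp) ?(ltW yc).
have c1 : 1 <= c0.
  rewrite -[leLHS](ger0_norm ler01) -[leRHS](gtr0_norm cp) -ler_sqr ?nnegrE//.
  by rewrite !real_normK ?num_real// expr1n.
pose tau := sigma / sin theta.
have t0 : 0 < tau by rewrite divr_gt0.
pose h := c0 ^+ 3 * tau / `|sin (2 * theta)|.
pose s := 1 - 115 * h.
pose K := tau ^+ 2 * s / 4.
have h0 : 0 < h by rewrite divr_gt0// mulr_gt0.
(* This is the upper bound on [sigma] rewritten; it gives [115 h <= 1/2], so [s] lies between [1/2]
   and 1. *)
have h230 : h <= 230^-1.
  rewrite /h ler_pdivrMr// /tau mulrA ler_pdivrMr//.
  move: sgI; rewrite (ler_pdivlMr _ _ (mulr_gt0 (ltr0Sn R 459) c30)).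
  by clear; lra.
have kI' : 0 <= kappa <= 3 / 4 * (h * tau ^+ 2).
  rewrite k0 (le_trans kI)// le_eqVlt; apply/orP; left; apply/eqP.
  by rewrite /h /tau; field; rewrite sn0 Dn0.
have -> : 1 - 230 * c0 ^+ 3 * sigma / (2 * sin theta * `|sin (2 * theta)|) = s.
  by rewrite /s /h /tau; field; rewrite sn0 Dn0.
have [s1 s2] : 0 <= s /\ s <= 1 by rewrite /s; move: h0 h230; clear; lra.
have K0 : 0 <= K by rewrite divr_ge0// mulr_ge0// sqr_ge0.
have pb u : 2 / 3 <= potential R theta s K u <= 4 / 3.
  apply: potential_bound => //; first by rewrite s1.
  exact: (corrector_weight_bound _ _ _ c0 h).
have p0 u : 0 <= potential R theta s K u.
  by have /andP[+ _] := pb u; apply: le_trans; lra.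
pose phi (y : R) : (R * R) * R := (shear_step R theta tau (1, 0) y, 0).
pose step := stopped_step R theta tau kappa B.
pose S := driven_chain T _ R (phi \o om 0%N) step (fun j => om j).
pose V (e : (R * R) * R) : \bar R := (weighted_potential R theta s K e)%:E.
have mphi : measurable_fun setT phi.
  by apply: measurable_fun_pair => //; exact: measurable_shear_step.
have mstep := measurable_stopped_step R theta tau kappa B.
have mV : measurable_fun setT V.
  by apply/measurable_EFinP; exact: measurable_weighted_potential.
have V0 e : (0 <= V e)%E by rewrite lee_fin mulr_ge0 ?expR_ge0.
have mS n : measurable_fun setT (S n).
  by apply: measurable_driven_chain => //; exact: measurableT_comp.
pose A n := [set x | B <= (S n x).2].
have mA n : measurable (A n).
  have mb : measurable_fun setT (fun x => B <= (S n x).2).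
    apply: measurable_fun_ler => //.
    exact: (measurableT_comp measurable_snd (mS n)).
  rewrite -[A n]setTI; exact: (mb measurableT [set true]).
have PA k : (P (A k) <= (2 * expR (- (B * s)))%:E)%E.
  (* Markov's inequality: [c] bounds the weighted potential from below on [A k], while its integral
     is at most the initial [4/3]. *)
  pose c := 2 / 3 * expR (s * B).
  have c00 : 0 < c by rewrite mulr_gt0 ?expR_gt0.
  have -> : 2 * expR (- (B * s)) = c^-1 * (4 / 3).
    by rewrite expRN /c [B * s]mulrC; field; rewrite gt_eqF ?expR_gt0.
  rewrite EFinM lee_pdivlMl//.
  have mVS : measurable_fun setT (V \o S k) by exact: measurableT_comp.
  have Vle : (\int[P]_x V (S k x) <= (4 / 3)%:E)%E.
    have Vstep e j : (\int[P]_x V (step e (om j x)) <= V e)%E.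
      exact: (stopped_step_supermartingale _ T R P _ theta tau c0 kappa B h).
    apply: le_trans (driven_chain_supermartingale _ _ T _ R P om phi step V k
      ind mphi mstep mV V0 Vstep) _.
    apply: (@le_trans _ _ (\int[P]_x (cst (4 / 3)%:E x))%E).
      apply: ge0_le_integral => //.
      + apply: (measurableT_comp mV); exact: measurableT_comp.
      + move=> x _; rewrite lee_fin /weighted_potential /= mulr0 expR0 mulr1.
        by have /andP[] := pb (phi (om 0%N x)).1.
    by rewrite integral_cst//= [P setT]probability_setT mule1.
  apply: le_trans Vle.
  apply: (@le_trans _ _ (\int[P]_(x in A k) V (S k x))%E); last first.
    by apply: ge0_subset_integral => //; exact: mA.
  rewrite -(integral_cst P (mA k)); apply: ge0_le_integral => //.
  + by move=> x _; rewrite lee_fin ltW.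
  + exact: measurable_funTS.
  move=> x Ax; rewrite lee_fin /weighted_potential ler_pM ?expR_ge0//.
    by have /andP[] := pb (S k x).1.
  by rewrite ler_expR ler_wpM2l.
have <- : \bigcup_n A n = [set x | exists n : nat, (1 <= n)%N /\
      ((ln (Yk theta sigma (fun j => om j.-1 x) n) + kappa * n%:R)
      - (ln (Yk theta sigma (fun j => om j.-1 x) 1) + kappa) >= B)%R].
  pose u x := orbit_vec R theta tau (fun j => om j.-1 x).
  pose l x k := ln (nsq R (u x 1%N)) - ln (nsq R (u x k.+1)) + kappa * k%:R.
  have LE x k : ln (Yk theta sigma (fun j => om j.-1 x) k.+1) + kappa * k.+1%:R
      - (ln (Yk theta sigma (fun j => om j.-1 x) 1) + kappa) = l x k.
    rewrite !Yk_nsq// !ln_div ?posrE ?orbit_vec_gt0// -[k.+1%:R]natr1.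
    by rewrite /l /u /tau; ring.
  have SE x k : (exists j, S k x = (u x j.+1, l x j)) /\
      ((S k x).2 < B -> S k x = (u x k.+1, l x k)).
    exact: stopped_chain_orbit.
  apply/seteqP; split => x.
    move=> [k _]; rewrite /A /=; have [[j ->] _] := SE x k.
    by move=> hB; exists j.+1; split=> //; rewrite LE.
  move=> [k [k1]]; rewrite -(prednK k1) LE => hB; exists k.-1 => //; rewrite /A /=.
  rewrite leNgt; apply/negP => hlt.
  by have := hlt; rewrite (SE x k.-1).2//= ltNge hB.
(* Once at level [B] the chain stays there, so the bound for each fixed time passes to the union by
   continuity of the measure. *)
have ndA : nondecreasing_seq A.
  apply/nondecreasing_seqP => n; apply/subsetPset => x; rewrite /A /= => h1.
  rewrite [S n.+1 x](_ : _ = step (S n x) (om n.+1 x))//.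
  by rewrite /step /stopped_step h1.
have cA := nondecreasing_cvg_mu (mu := P) mA (bigcup_measurable (fun i _ => mA i)) ndA.
rewrite -(cvg_lim _ cA)//; apply: lime_le; first by apply/cvg_ex; eexists; exact: cA.
by apply: nearW => n; exact: PA.
Qed.
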